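(* Let $C, D, A, B$ be unital $C^*$-algebras. Let $\phi:C\to A$ and $\psi:D\to B$ be completely positive linear maps, and let $E_\phi$ and $E_\psi$ be the GNS-$C^*$-correspondences induced by $\phi$ and $\psi$ (a $C$-$A$-correspondence and a $D$-$B$-correspondence, respectively). For an $A$-$B$-equivalence bimodule $X$, let $T:A\to\mathbf{B}_B(X)$ be the isomorphism $T_a(x)=a\cdot x$ ($a\in A$, $x\in X$), and let $\phi_T=T\circ\phi:C\to\mathbf{B}_B(X)$. Then the following hold: (1) If there is an $A$-$B$-equivalence bimodule $X$ such that $\phi_T$ and $\psi$ are strongly Morita equivalent as completely positive linear maps, then $E_\phi$ and $E_\psi$ are strongly Morita equivalent as GNS-$C^*$-correspondences. (2) If $E_\phi$ and $E_\psi$ are strongly Morita equivalent as GNS-$C^*$-correspondences, then there is an $A$-$B$-equivalence bimodule $X$ such that $\phi_T$ and $\psi$ are strongly Morita equivalent as completely positive linear maps.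
   Context: For right Hilbert $B$-modules $E,F$, $\mathbf{B}_B(F,E)$ is the space of bounded adjointable right $B$-module maps $F\to E$, and $\mathbf{B}_B(E)=\mathbf{B}_B(E,E)$. An equivalence bimodule is an imprimitivity bimodule (full left and right inner products, compatible). The GNS-$C^*$-correspondence $E_\phi$ of a completely positive linear map $\phi:C\to A$ is the $C$-$A$-correspondence obtained by separating and completing the algebraic tensor product $C\odot A$ with respect to $\langle c\otimes a, c_1\otimes a_1\rangle_A=a^*\phi(c^*c_1)a_1$, with actions $c_1\cdot(c\otimes a)\cdot a_1=c_1c\otimes aa_1$. Similarly for $E_\psi$. $E_\phi$ and $E_\psi$ are strongly Morita equivalent (as GNS-$C^*$-correspondences) if there exist a $C$-$D$-equivalence bimodule $Y$ and an $A$-$B$-equivalence bimodule $X$ such that $E_\phi\otimes_A X$ is isomorphic to $Y\otimes_D E_\psi$ as $C$-$B$-correspondences, i.e. there is a linear map $\Phi$ from $E_\phi\otimes_A X$ onto $Y\otimes_D E_\psi$ with $\Phi(c\cdot x\cdot b)=c\cdot\Phi(x)\cdot b$ and $\langle\Phi(x),\Phi(y)\rangle_B=\langle x,y\rangle_B$ for all $x,y\in E_\phi\otimes_A X$, $c\in C$, $b\in B$. Regard $B$ as the trivial right Hilbert $B$-module and $\psi$ as a completely positive map $D\to\mathbf{B}_B(B)\cong B$. For a completely positive linear map $\theta:D\to\mathbf{B}_B(F)$, a minimal KSGNS-representation is a triple $(\pi_\theta,V_\theta,F_\theta)$ with $F_\theta$ a right Hilbert $B$-module, $\pi_\theta:D\to\mathbf{B}_B(F_\theta)$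 a $*$-homomorphism, $V_\theta\in\mathbf{B}_B(F,F_\theta)$, $\theta(d)=V_\theta^*\pi_\theta(d)V_\theta$ for all $d\in D$, and $\overline{\pi_\theta(D)V_\theta F}=F_\theta$ (it exists and is unique up to unitary equivalence). Representations $(\pi_C,E)$ of $C$ and $(\pi_D,F)$ of $D$ on right Hilbert $B$-modules, non-degenerate in the sense that $\overline{\pi_C(C)E}=E$ and $\overline{\pi_D(D)F}=F$, are strongly Morita equivalent if there exist a $C$-$D$-equivalence bimodule $Y$ and a linear map $\pi_Y:Y\to\mathbf{B}_B(F,E)$ such that for all $y,z\in Y$, $c\in C$, $d\in D$: $\pi_Y(y)\pi_Y(z)^*=\pi_C({}_C\langle y,z\rangle)$; $\pi_Y(y)^*\pi_Y(z)=\pi_D(\langle y,z\rangle_D)$; $\pi_Y(c\cdot y\cdot d)=\pi_C(c)\pi_Y(y)\pi_D(d)$. Completely positive linear maps $C\to\mathbf{B}_B(E)$ and $D\to\mathbf{B}_B(F)$ are strongly Morita equivalent if a minimal KSGNS-representation for the first is strongly Morita equivalent to a minimal KSGNS-representation for the second. *)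

(* Defs.v *)
From HB Require Import structures.
From mathcomp Require Import all_boot all_order all_algebra.
From mathcomp Require Import all_classical all_reals all_analysis.
From mathcomp Require Import complex.

Set Implicit Arguments.
Unset Strict Implicit.
Unset Printing Implicit Defensive.

Import Order.TTheory GRing.Theory Num.Theory.
Import numFieldNormedType.Exports.

Local Open Scope classical_set_scope.
Local Open Scope complex_scope.
Local Open Scope ring_scope.

(* The complex numbers are [R[i]] for an arbitrary [R : realType]; norms are
   therefore [R[i]]-valued, and [x <= y] between them means that [y - x] is a
   nonnegative real. *)

(* Unital C*-algebras; the zero algebra is not excluded. The ring operations are
   part of the mixin, and a canonical [pzRingType] is declared below, because
   Hierarchy-Builder does not accept a structure joining [CompleteNormedModule]
   and [PzRing]. *)
HB.mixin Record isCStarAlgebra (R : realType) A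
    of CompleteNormedModule R[i] A := {
  cone : A ;
  cmul : A -> A -> A ;
  star : A -> A ;
  cmulA : associative cmul ;
  cmul1l : left_id cone cmul ;
  cmul1r : right_id cone cmul ;
  cmulDl : left_distributive cmul +%R ;
  cmulDr : right_distributive cmul +%R ;
  cscaleAl : forall (k : R[i]) (x y : A), k *: cmul x y = cmul (k *: x) y ;
  cscaleAr : forall (k : R[i]) (x y : A), k *: cmul x y = cmul x (k *: y) ;
  starD : forall x y : A, star (x + y) = star x + star y ;
  starZ : forall (k : R[i]) (x : A), star (k *: x) = (k^*)%C *: star x ;
  starM : forall x y : A, star (cmul x y) = cmul (star y) (star x) ;
  starK : involutive star ;
  cnormM : forall x y : A, `|cmul x y| <= `|x| * `|y| ;
  cnorm_star : forall x : A, `|cmul (star x) x| = `|x| ^+ 2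
}.

#[short(type="cstarType")]
HB.structure Definition CStarAlgebra (R : realType) :=
  {A of CompleteNormedModule R[i] A & isCStarAlgebra R A}.

HB.instance Definition _ (R : realType) (A : cstarType R) :=
  GRing.Zmodule_isPzRing.Build A (@cmulA R A) (@cmul1l R A) (@cmul1r R A)
    (@cmulDl R A) (@cmulDr R A).

Definition cstar_positive (R : realType) (A : cstarType R) (a : A) : Prop :=
  exists b : A, a = star b * b.

Definition mx_star (R : realType) (A : cstarType R) n (M : 'M[A]_n) : 'M[A]_n :=
  (map_mx (@star R A) M)^T.

(* Positivity in the C*-algebra of [n x n] matrices over [A]. *)
Definition mx_positive (R : realType) (A : cstarType R) n (M : 'M[A]_n) : Prop :=
  exists N : 'M[A]_n, M = mx_star N *m N.

Definition completely_positive (R : realType) (C A : cstarType R)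
    (phi : C -> A) : Prop :=
  forall n (M : 'M[C]_n), mx_positive M -> mx_positive (map_mx phi M).

Definition closed_span (R : realType) (V : normedModType R[i]) (S : set V) :
    set V :=
  closure [set v : V | exists n (k : 'I_n -> R[i]) (g : 'I_n -> V),
    (forall i, S (g i)) /\ v = \sum_(i < n) k i *: g i].

(* Right Hilbert [B]-modules; inner products are linear in the second
   variable. The carrier is complete for its norm, which [hnormE] identifies
   with the norm induced by the inner product. *)
Record hilbert_module (R : realType) (B : cstarType R) := HilbertModule {
  hcar :> completeNormedModType R[i] ;
  ract : hcar -> B -> hcar ;
  inner : hcar -> hcar -> B ;
  ractDl : forall x y b, ract (x + y) b = ract x b + ract y b ;
  ractDr : forall x b c, ract x (b + c) = ract x b + ract x c ;
  ractA : forall x b c, ract x (b * c) = ract (ract x b) c ;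
  ract1 : forall x, ract x 1 = x ;
  ractZl : forall (k : R[i]) x b, ract (k *: x) b = k *: ract x b ;
  ractZr : forall (k : R[i]) x b, ract x (k *: b) = k *: ract x b ;
  innerDr : forall x y z, inner x (y + z) = inner x y + inner x z ;
  innerZr : forall (k : R[i]) x y, inner x (k *: y) = k *: inner x y ;
  inner_ract : forall x y b, inner x (ract y b) = inner x y * b ;
  inner_star : forall x y, star (inner x y) = inner y x ;
  inner_pos : forall x, cstar_positive (inner x x) ;
  hnormE : forall x, `|x| ^+ 2 = `|inner x x|
}.

Arguments ract {R B} _ _ _.
Arguments inner {R B} _ _ _.

(* [adjointable F E] is B_B(F, E); [aadj T] is the function underlying the
   adjoint of [T]. *)
Record adjointable (R : realType) (B : cstarType R) (F E : hilbert_module B) :=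
  Adjointable {
  aop :> F -> E ;
  aadj : E -> F ;
  aopD : forall x y, aop (x + y) = aop x + aop y ;
  aopZ : forall (k : R[i]) x, aop (k *: x) = k *: aop x ;
  aop_ract : forall x b, aop (ract F x b) = ract E (aop x) b ;
  aop_bounded : exists M : R[i], forall x, `|aop x| <= M * `|x| ;
  aadjP : forall x y, inner E (aop x) y = inner F x (aadj y)
}.

Definition star_hom (R : realType) (C B : cstarType R) (E : hilbert_module B)
    (pi : C -> adjointable E E) : Prop :=
  [/\ forall c d x, pi (c + d) x = pi c x + pi d x,
      forall (k : R[i]) c x, pi (k *: c) x = k *: pi c x,
      forall c d x, pi (c * d) x = pi c (pi d x)
    & forall c x, pi (star c) x = aadj (pi c) x].

(* C-B-correspondences: right Hilbert [B]-modules with a *-homomorphism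
   [C -> B_B(E)] as left action. *)
Record correspondence (R : realType) (C B : cstarType R) := Correspondence {
  cmod :> hilbert_module B ;
  lact : C -> adjointable cmod cmod ;
  lact_hom : star_hom lact
}.

Arguments lact {R C B} _ _.

(* Equivalence (imprimitivity) bimodules; [linner] is the left inner product,
   linear in the first variable. *)
Record equivalence_bimodule (R : realType) (A B : cstarType R) :=
  EquivalenceBimodule {
  ebcorr :> correspondence A B ;
  linner : ebcorr -> ebcorr -> A ;
  linnerDl : forall x y z, linner (x + y) z = linner x z + linner y z ;
  linnerZl : forall (k : R[i]) x y, linner (k *: x) y = k *: linner x y ;
  linner_lact : forall a x y, linner (lact ebcorr a x) y = a * linner x y ;
  linner_star : forall x y, star (linner x y) = linner y x ;
  linner_pos : forall x, cstar_positive (linner x x) ;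
  lnormE : forall x, `|x| ^+ 2 = `|linner x x| ;
  linner_ract : forall x y b,
    linner (ract ebcorr x b) y = linner x (ract ebcorr y (star b)) ;
  linner_inner : forall x y z,
    lact ebcorr (linner x y) z = ract ebcorr x (inner ebcorr y z) ;
  linner_full :
    closed_span [set a : A | exists x y, a = linner x y] = setT ;
  inner_full :
    closed_span [set b : B | exists x y, b = inner ebcorr x y] = setT
}.

Arguments linner {R A B} _ _ _.

Definition bilinear_map (R : realType) (U V W : normedModType R[i])
    (t : U -> V -> W) : Prop :=
  [/\ forall u u' v, t (u + u') v = t u v + t u' v,
      forall (k : R[i]) u v, t (k *: u) v = k *: t u v,
      forall u v v', t u (v + v') = t u v + t u v'
    & forall (k : R[i]) u v, t u (k *: v) = k *: t u v].

(* [E] is a separated completion of the algebraic tensor product of [C] and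
   [A] for the semi-inner product defined by [phi]: [t], viewed as a linear map
   on the algebraic tensor product, preserves the inner products and the
   actions and has dense range. This determines [E] up to isomorphism of
   correspondences. *)
Definition is_GNS (R : realType) (C A : cstarType R) (phi : C -> A)
    (E : correspondence C A) : Prop :=
  exists t : C -> A -> E,
    [/\ bilinear_map t,
        forall c a c1 a1,
          inner E (t c a) (t c1 a1) = star a * phi (star c * c1) * a1,
        forall c1 c a, lact E c1 (t c a) = t (c1 * c) a,
        forall c a a1, ract E (t c a) a1 = t c (a * a1)
      & closed_span [set e : E | exists c a, e = t c a] = setT].

(* [P] is the interior tensor product of [E] and [X] over [A], in the same
   sense. *)
Definition is_tensor (R : realType) (C A B : cstarType R)
    (E : correspondence C A) (X : correspondence A B) (P : correspondence C B) :
    Prop :=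
  exists t : E -> X -> P,
    bilinear_map t /\
    [/\ forall e a x, t (ract E e a) x = t e (lact X a x),
        forall e x e1 x1, inner P (t e x) (t e1 x1) =
          inner X x (lact X (inner E e e1) x1),
        forall c e x, lact P c (t e x) = t (lact E c e) x,
        forall e x b, ract P (t e x) b = t e (ract X x b)
      & closed_span [set p : P | exists e x, p = t e x] = setT].

Definition correspondence_iso (R : realType) (C B : cstarType R)
    (P Q : correspondence C B) : Prop :=
  exists Phi : P -> Q,
    [/\ (forall x y, Phi (x + y) = Phi x + Phi y) /\
          (forall (k : R[i]) x, Phi (k *: x) = k *: Phi x),
        forall q, exists p, Phi p = q,
        forall c x b, Phi (lact P c (ract P x b)) = lact Q c (ract Q (Phi x) b)
      & forall x y, inner Q (Phi x) (Phi y) = inner P x y].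

Definition correspondence_SME (R : realType) (C A D B : cstarType R)
    (E : correspondence C A) (F : correspondence D B) : Prop :=
  exists (Y : equivalence_bimodule C D) (X : equivalence_bimodule A B)
      (P Q : correspondence C B),
    [/\ is_tensor E X P, is_tensor Y F Q & correspondence_iso P Q].

Definition minimal_KSGNS (R : realType) (D B : cstarType R)
    (F Ft : hilbert_module B) (theta : D -> adjointable F F)
    (pi : D -> adjointable Ft Ft) (V : adjointable F Ft) : Prop :=
  [/\ star_hom pi,
      forall d x, theta d x = aadj V (pi d (V x))
    & closed_span [set y : Ft | exists d x, y = pi d (V x)] = setT].

Definition nondegenerate (R : realType) (C B : cstarType R)
    (E : hilbert_module B) (pi : C -> adjointable E E) : Prop :=
  closed_span [set y : E | exists c x, y = pi c x] = setT.

Definition representation_SME (R : realType) (C D B : cstarType R)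
    (E F : hilbert_module B)
    (piC : C -> adjointable E E) (piD : D -> adjointable F F) : Prop :=
  nondegenerate piC /\ nondegenerate piD /\
  exists (Y : equivalence_bimodule C D) (piY : Y -> adjointable F E),
    ((forall y z f, piY (y + z) f = piY y f + piY z f) /\
     (forall (k : R[i]) y f, piY (k *: y) f = k *: piY y f)) /\
    [/\ forall y z e, piY y (aadj (piY z) e) = piC (linner Y y z) e,
        forall y z f, aadj (piY y) (piY z f) = piD (inner Y y z) f
      & forall c y d f,
          piY (lact Y c (ract Y y d)) f = piC c (piY y (piD d f))].

Definition cp_SME (R : realType) (C D B : cstarType R) (E F : hilbert_module B)
    (theta : C -> adjointable E E) (eta : D -> adjointable F F) : Prop :=
  exists (Et Ft : hilbert_module B)
      (pi : C -> adjointable Et Et) (V : adjointable E Et)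
      (rho : D -> adjointable Ft Ft) (W : adjointable F Ft),
    [/\ minimal_KSGNS theta pi V, minimal_KSGNS eta rho W
      & representation_SME pi rho].

Section TrivialModule.
Variables (R : realType) (B : cstarType R).

Lemma self_inner_star (x y : B) : star (star x * y) = star y * x.
Proof. by rewrite starM starK. Qed.

Lemma self_inner_pos (x : B) : cstar_positive (star x * x).
Proof. by exists x. Qed.

Definition self_module : hilbert_module B :=
  @HilbertModule R B B (fun x b => x * b) (fun x y => star x * y)
    (@mulrDl B) (@mulrDr B) (@mulrA B) (@mulr1 B)
    (fun k x b => esym (cscaleAl k x b))
    (fun k x b => esym (cscaleAr k x b))
    (fun x => mulrDr (star x))
    (fun k x y => esym (cscaleAr k (star x) y))
    (fun x y b => mulrA (star x) y b)
    self_inner_star self_inner_pos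
    (fun x => esym (cnorm_star x)).

Lemma lmul_bounded (b : B) : exists M : R[i], forall x : B, `|b * x| <= M * `|x|.
Proof. by exists `|b| => x; exact: cnormM. Qed.

Lemma lmul_adj (b x y : B) : star (b * x) * y = star x * (star b * y).
Proof. by rewrite starM mulrA. Qed.

(* The isomorphism of [B] with B_B(B). *)
Definition lmul_op (b : B) : adjointable self_module self_module :=
  @Adjointable R B self_module self_module
    (fun x : B => b * x) (fun x : B => star b * x)
    (mulrDr b) (fun k x => esym (cscaleAr k b x))
    (fun x c => mulrA b x c) (lmul_bounded b) (lmul_adj b).

End TrivialModule.

(* Main.v *)
Require Import Defs.
From HB Require Import structures.
From mathcomp Require Import all_boot all_order all_algebra.
From mathcomp Require Import all_classical all_reals all_analysis.
From mathcomp Require Import complex.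
From mathcomp Require Import ring.

(* For (1), the KSGNS space of [phi_T] with its representation [pi] of [C] is
   itself a tensor product of [E_phi] and [X], through
   [(c (x) a) (x) x |-> pi(c) V (a x)], and also one of [Y] and [E_psi]: the map
   [d (x) b |-> rho(d) W b] identifies [E_psi] with the KSGNS space of [psi], and
   [y (x) f |-> pi_Y(y) f] does the rest. For (2), [E_phi (x) X] and [E_psi] carry
   minimal KSGNS representations with [V x = (1 (x) 1) (x) x] and
   [W b = 1 (x) b], and [pi_Y(y) f] is the preimage of [y (x) f] under the given
   isomorphism.

   No positivity theory of C*-algebras enters: for continuity the weak
   Cauchy-Schwarz inequality [|<x, y>| <= 4 |x| |y|], a consequence of
   polarization and the triangle inequality, is enough, and the left action on
   an equivalence bimodule is contractive because the left inner product computes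
   the norm. *)

Set Implicit Arguments.
Unset Strict Implicit.
Unset Printing Implicit Defensive.

Import Order.TTheory GRing.Theory Num.Theory.
Import numFieldNormedType.Exports.

Local Open Scope classical_set_scope.
Local Open Scope complex_scope.
Local Open Scope ring_scope.

(** * Bounded linear maps and dense subspaces *)

Section BoundedLinear.
Variable R : realType.
Implicit Types U V W : normedModType R[i].

Definition bounded_linear_map U V (f : U -> V) : Prop :=
  [/\ forall x y, f (x + y) = f x + f y,
      forall (k : R[i]) x, f (k *: x) = k *: f x
    & exists2 M : R[i], 0 <= M & forall x, `|f x| <= M * `|x| ].

Lemma blin0 U V (f : U -> V) : bounded_linear_map f -> f 0 = 0.
Proof. by case=> _ fZ _; rewrite -(scale0r (0 : U)) fZ scale0r. Qed.

Lemma blinN U V (f : U -> V) : bounded_linear_map f -> {morph f : x / - x}.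
Proof. by case=> _ fZ _ x; rewrite -(scaleN1r x) fZ scaleN1r. Qed.

Lemma blinB U V (f : U -> V) : bounded_linear_map f -> {morph f : x y / x - y}.
Proof. by move=> Hf x y; have [fD _ _] := Hf; rewrite fD blinN. Qed.

Lemma blin_id U : bounded_linear_map (@id U).
Proof. by split=> //; exists 1 => // x; rewrite mul1r. Qed.

Lemma blin_comp U V W (g : V -> W) (f : U -> V) :
  bounded_linear_map g -> bounded_linear_map f ->
  bounded_linear_map (fun x => g (f x)).
Proof.
move=> [gD gZ [M M0 gM]] [fD fZ [N N0 fN]]; split=> [x y|k x|].
- by rewrite fD gD.
- by rewrite fZ gZ.
- exists (M * N) => [|x]; first exact: mulr_ge0.
  by apply: le_trans (gM _) _; rewrite -mulrA ler_wpM2l.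
Qed.

Lemma blin_add U V (f g : U -> V) :
  bounded_linear_map f -> bounded_linear_map g ->
  bounded_linear_map (fun x => f x + g x).
Proof.
move=> [gD gZ [M M0 gM]] [fD fZ [N N0 fN]]; split=> [x y|k x|].
- by rewrite fD gD addrACA.
- by rewrite fZ gZ scalerDr.
- exists (M + N) => [|x]; first exact: addr_ge0.
  by apply: le_trans (ler_normD _ _) _; rewrite mulrDl lerD.
Qed.

Lemma blin_scale U V (k : R[i]) (f : U -> V) :
  bounded_linear_map f -> bounded_linear_map (fun x => k *: f x).
Proof.
move=> [gD gZ [M M0 gM]]; split=> [x y|k' x|].
- by rewrite gD scalerDr.
- by rewrite gZ !scalerA mulrC.
- exists (`|k| * M) => [|x]; first exact: mulr_ge0.
  by rewrite normrZ -mulrA ler_wpM2l.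
Qed.

Lemma approx_eq0 V (x : V) (K : R[i]) : 0 <= K ->
  (forall e, 0 < e -> `|x| <= K * e) -> x = 0.
Proof.
move=> K0 H; apply/eqP; rewrite -normr_le0; apply/ler_addgt0Pr => e e0.
rewrite add0r; have K1 : 0 < K + 1 by rewrite ltr_wpDl.
apply: le_trans (H (e / (K + 1)) _) _; first by rewrite divr_gt0.
by rewrite mulrA ler_pdivrMr // mulrC ler_pM2l // lerDl.
Qed.

(** The order on [R[i]] is only partial, but positive elements are real, so any two of them are
    comparable. *)
Lemma pos_lower_bound (e f : R[i]) : 0 < e -> 0 < f ->
  exists2 m, 0 < m & m <= e /\ m <= f.
Proof.
move=> e0 f0; have [ef|fe] := real_leP (gtr0_real e0) (gtr0_real f0).
- by exists e.
- by exists f => //; split=> //; exact: ltW.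
Qed.

Definition linear_span V (S : set V) : set V :=
  [set v : V | exists n (k : 'I_n -> R[i]) (g : 'I_n -> V),
    (forall i, S (g i)) /\ v = \sum_(i < n) k i *: g i].

Lemma linear_span_ind V (S P : set V) : P 0 ->
  (forall x y, P x -> P y -> P (x + y)) ->
  (forall (k : R[i]) x, P x -> P (k *: x)) -> S `<=` P -> linear_span S `<=` P.
Proof.
move=> P0 PD PZ SP v [n [k [g [Sg ->]]]].
by apply: big_ind => // i _; apply/PZ/SP.
Qed.

Lemma linear_span_gen V (S : set V) : S `<=` linear_span S.
Proof.
move=> v Sv; exists 1%N, (fun=> 1), (fun=> v).
by split=> //; rewrite big_ord1 scale1r.
Qed.

Lemma linear_span0 V (S : set V) : linear_span S 0.
Proof.
by exists 0%N, (fun=> 0), (fun=> 0); split=> [[]//|]; rewrite big_ord0.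
Qed.

Lemma linear_spanZ V (S : set V) (k : R[i]) x :
  linear_span S x -> linear_span S (k *: x).
Proof.
move=> [n [l [g [Sg ->]]]]; exists n, (fun i => k * l i), g; split=> //.
by rewrite scaler_sumr; apply: eq_bigr => i _; rewrite scalerA.
Qed.

Lemma linear_spanD V (S : set V) x y :
  linear_span S x -> linear_span S y -> linear_span S (x + y).
Proof.
move=> [n [k [g [Sg ->]]]] [m [l [h [Sh ->]]]].
exists (n + m)%N, (fun i => match fintype.split i with inl j => k j | inr j => l j end),
  (fun i => match fintype.split i with inl j => g j | inr j => h j end).
split=> [i|]; first by case: fintype.split.
rewrite big_split_ord /=; congr (_ + _); apply: eq_bigr => i _.
- by rewrite (unsplitK (inl i)).
- by rewrite (unsplitK (inr i)).
Qed.

Lemma closed_spanP V (S : set V) v : closed_span S v <->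
  forall e : R[i], 0 < e -> exists2 w, linear_span S w & `|v - w| < e.
Proof.
split=> [Hv e e0|Hv A].
- have [w [Sw vw]] := Hv _ (nbhsx_ballx v e e0).
  by exists w => //; move: vw; rewrite -ball_normE.
- case/nbhs_ballP=> e e0 eA; have [w Sw vw] := Hv _ e0.
  by exists w; split=> //; apply: eA; rewrite -ball_normE.
Qed.

Lemma closed_span_gen V (S : set V) : S `<=` closed_span S.
Proof.
move=> v Sv; apply/closed_spanP => e e0; exists v; first exact: linear_span_gen.
by rewrite subrr normr0.
Qed.

Lemma closed_span_span V (S : set V) : linear_span S `<=` closed_span S.
Proof.
move=> v Sv; apply/closed_spanP => e e0; exists v => //.
by rewrite subrr normr0.
Qed.

Lemma closed_spanD V (S : set V) x y :
  closed_span S x -> closed_span S y -> closed_span S (x + y).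
Proof.
move=> /closed_spanP Hx /closed_spanP Hy; apply/closed_spanP => e e0.
have e2 : 0 < e / 2 by rewrite divr_gt0.
have [x' Sx xx] := Hx _ e2; have [y' Sy yy] := Hy _ e2.
exists (x' + y'); first exact: linear_spanD.
rewrite opprD addrACA; apply: le_lt_trans (ler_normD _ _) _.
by rewrite (splitr e) ltrD.
Qed.

Lemma closed_spanZ V (S : set V) (k : R[i]) x :
  closed_span S x -> closed_span S (k *: x).
Proof.
move=> /closed_spanP Hx; apply/closed_spanP => e e0.
have k1 : 0 < `|k| + 1 by rewrite ltr_wpDl.
have [|x' Sx xx] := Hx (e / (`|k| + 1)); first by rewrite divr_gt0.
exists (k *: x'); first exact: linear_spanZ.
rewrite -scalerBr normrZ; move: xx; rewrite ltr_pdivlMr // => xx.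
by apply: le_lt_trans xx; rewrite mulrC ler_wpM2l // lerDl.
Qed.

Lemma closed_span_closed V (S : set V) v :
  (forall e : R[i], 0 < e -> exists2 w, closed_span S w & `|v - w| < e) ->
  closed_span S v.
Proof.
move=> Hv; apply/closed_spanP => e e0.
have e2 : 0 < e / 2 by rewrite divr_gt0.
have [w /closed_spanP Hw vw] := Hv _ e2; have [w' Sw ww] := Hw _ e2.
exists w' => //; rewrite (_ : v - w' = (v - w) + (w - w')); last by rewrite addrA subrK.
by apply: le_lt_trans (ler_normD _ _) _; rewrite (splitr e) ltrD.
Qed.

Lemma dense_ind V (S P : set V) : closed_span S = setT -> P 0 ->
  (forall x y, P x -> P y -> P (x + y)) ->
  (forall (k : R[i]) x, P x -> P (k *: x)) -> S `<=` P ->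
  forall (v : V) (e : R[i]), 0 < e -> exists2 w, P w & `|v - w| < e.
Proof.
move=> ST P0 PD PZ SP v e e0.
have : closed_span S v by rewrite ST.
move=> /closed_spanP /(_ _ e0) [w Sw vw]; exists w => //.
exact: linear_span_ind Sw.
Qed.

(** The difference [f - g] is bounded and vanishes on the span of [S], so its value at [u] is
    controlled by the distance from [u] to that span. Most identities below are checked on
    generators in this way. *)
Lemma blin_eq U V (S : set U) (f g : U -> V) : closed_span S = setT ->
  bounded_linear_map f -> bounded_linear_map g ->
  (forall s, S s -> f s = g s) -> forall u, f u = g u.
Proof.
move=> ST Hf Hg fg u; apply/eqP; rewrite -subr_eq0; apply/eqP.
have [M M0 HM] : exists2 M : R[i], 0 <= M & forall x, `|f x - g x| <= M * `|x|.
  have [_ _] := blin_add Hf (blin_scale (-1) Hg).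
  case=> M M0 HM; exists M => // x.
  by have := HM x; rewrite scaleN1r.
have [fD fZ _] := Hf; have [gD gZ _] := Hg.
apply: (approx_eq0 M0) => e e0.
have [w Pw vw] : exists2 w, f w = g w & `|u - w| < e.
  apply: (@dense_ind _ S [set w | f w = g w] ST) => //=.
  - by rewrite (blin0 Hf) (blin0 Hg).
  - by move=> x y /= fx fy; rewrite fD gD fx fy.
  - by move=> k x /= fx; rewrite fZ gZ fx.
rewrite (_ : f u - g u = f (u - w) - g (u - w)).
  by apply: le_trans (HM _) _; rewrite ler_wpM2l // ltW.
by rewrite (blinB Hf) (blinB Hg) Pw opprB addrA subrK.
Qed.

Lemma blin_closed_span U V (S : set U) (S' : set V) (f : U -> V) :
  closed_span S = setT -> bounded_linear_map f ->
  (forall s, S s -> closed_span S' (f s)) -> forall u, closed_span S' (f u).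
Proof.
move=> ST Hf SS' u; have [fD fZ [M M0 fM]] := Hf.
apply: closed_span_closed => e e0.
have M1 : 0 < M + 1 by rewrite ltr_wpDl.
have [||||w Pw uw] := @dense_ind _ S [set w | closed_span S' (f w)] ST _ _ _ SS' u
  (e / (M + 1)).
- by rewrite /= (blin0 Hf); apply/closed_span_span/linear_span0.
- by move=> x y /= Sx Sy; rewrite fD; exact: closed_spanD.
- by move=> k x /= Sx; rewrite fZ; exact: closed_spanZ.
- by rewrite divr_gt0.
exists (f w) => //; rewrite -(blinB Hf); apply: le_lt_trans (fM _) _.
move: uw; rewrite ltr_pdivlMr // => uw.
by apply: le_lt_trans uw; rewrite mulrC ler_wpM2l // lerDl.
Qed.

End BoundedLinear.

(** * Continuous extension of a densely defined bounded linear relation *)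

Section Extension.
Variables (R : realType) (U : normedModType R[i]) (V : completeNormedModType R[i]).
Variable Gr : U -> V -> Prop.
Variable K : R[i].
Hypothesis GrD : forall u v u' v', Gr u v -> Gr u' v' -> Gr (u + u') (v + v').
Hypothesis GrZ : forall (k : R[i]) u v, Gr u v -> Gr (k *: u) (k *: v).
Hypothesis K0 : 0 <= K.
Hypothesis GrK : forall u v, Gr u v -> `|v| <= K * `|u|.
Hypothesis Gr_dense : forall (u : U) (e : R[i]), 0 < e ->
  exists2 u', (exists v, Gr u' v) & `|u - u'| < e.

Let cl u v := forall e : R[i], 0 < e ->
  exists u' v', [/\ Gr u' v', `|u - u'| < e & `|v - v'| < e].

Let GrB u v u' v' : Gr u v -> Gr u' v' -> `|v - v'| <= K * `|u - u'|.
Proof.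
by move=> g g'; apply: GrK; rewrite -(scaleN1r v') -(scaleN1r u'); apply/GrD/GrZ.
Qed.

Let cl_total u : exists v, cl u v.
Proof.
(* The filter of values of [Gr] at points tending to [u]; its limit is the required value. *)
pose F : set_system V := [set A | exists2 e : R[i], 0 < e &
  forall u' v', Gr u' v' -> `|u - u'| < e -> A v'].
have FF : ProperFilter F.
  apply: Build_ProperFilter_ex => [A [e e0 eA]|].
    by have [u' [v' g] uu] := Gr_dense u e0; exists v'; exact: eA uu.
  split=> [|A B [e e0 eA] [f f0 fB]|A B AB [e e0 eA]].
  - by exists 1.
  - have [m m0 [me mf]] := pos_lower_bound e0 f0; exists m => // u' v' g uu.
    by split; [apply: eA g _ | apply: fB g _]; apply: lt_le_trans uu _.
  - by exists e => // u' v' g uu; apply/AB/(eA _ _ g uu).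
have K1 : 0 < K + 1 by rewrite ltr_wpDl.
have : cvg F.
  apply: cauchy_cvg; apply/cauchy_exP => e e0.
  (* Points within [d] of [u] are less than [e / (K + 1)] apart, and their values less than [e];
     dividing by [K + 1] covers [K = 0]. *)
  pose d := e / (K + 1) / 2.
  have d0 : 0 < d by rewrite !divr_gt0.
  have [u1 [v1 g1] uu1] := Gr_dense u d0.
  exists v1; exists d => // u' v' g uu; rewrite -ball_normE /=.
  apply: le_lt_trans (GrB g1 g) _.
  have lt : `|u1 - u'| < e / (K + 1).
    rewrite (_ : u1 - u' = (u1 - u) + (u - u')); last by rewrite addrA subrK.
    apply: le_lt_trans (ler_normD _ _) _.
    by rewrite (splitr (e / _)) ltrD // distrC.
  move: lt; rewrite ltr_pdivlMr // => lt.
  by apply: le_lt_trans lt; rewrite mulrC ler_wpM2l // lerDl.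
move=> /cvg_ex [v Fv]; exists v => e e0.
have [d d0 dA] : F (ball v e) by apply/Fv/nbhsx_ballx.
have [m m0 [md me]] := pos_lower_bound d0 e0.
have [u' [v' g] um] := Gr_dense u m0.
exists u', v'; split=> //; first exact: lt_le_trans me.
by have := dA _ _ g (lt_le_trans um md); rewrite -ball_normE.
Qed.

Let cl_gr u v : Gr u v -> cl u v.
Proof. by move=> g e e0; exists u, v; rewrite !subrr !normr0. Qed.

Let clD u v u' v' : cl u v -> cl u' v' -> cl (u + u') (v + v').
Proof.
move=> H H' e e0; have e2 : 0 < e / 2 by rewrite divr_gt0.
have [a [b [g1 ua vb]]] := H _ e2; have [a' [b' [g2 ua' vb']]] := H' _ e2.
exists (a + a'), (b + b'); split; first exact: GrD.
- rewrite opprD addrACA; apply: le_lt_trans (ler_normD _ _) _.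
  by rewrite (splitr e) ltrD.
- rewrite opprD addrACA; apply: le_lt_trans (ler_normD _ _) _.
  by rewrite (splitr e) ltrD.
Qed.

Let clZ (k : R[i]) u v : cl u v -> cl (k *: u) (k *: v).
Proof.
move=> H e e0; have k1 : 0 < `|k| + 1 by rewrite ltr_wpDl.
have [|a [b [g ua vb]]] := H (e / (`|k| + 1)); first by rewrite divr_gt0.
exists (k *: a), (k *: b); split; first exact: GrZ.
- rewrite -scalerBr normrZ; move: ua; rewrite ltr_pdivlMr // => lt.
  by apply: le_lt_trans lt; rewrite mulrC ler_wpM2l // lerDl.
- rewrite -scalerBr normrZ; move: vb; rewrite ltr_pdivlMr // => lt.
  by apply: le_lt_trans lt; rewrite mulrC ler_wpM2l // lerDl.
Qed.

Let clK u v : cl u v -> `|v| <= K * `|u|.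
Proof.
move=> H; apply/ler_addgt0Pr => e e0; have K1 : 0 < K + 1 by rewrite ltr_wpDl.
(* The error in [v] counts once and the error in [u] counts [K] times, in all
   [(K + 1) * (e / (K + 1)) = e]. *)
have [|a [b [g ua vb]]] := H (e / (K + 1)); first by rewrite divr_gt0.
have va : `|v| <= `|v - b| + `|b| by rewrite -{1}(subrK b v) ler_normD.
have aa : `|a| <= `|u - a| + `|u|.
  by rewrite -{1}(subKr u a) (le_trans (ler_normB _ _)) // addrC.
apply: le_trans va _; apply: le_trans (lerD (ltW vb) (GrK g)) _.
apply: le_trans (lerD (lexx _) (ler_wpM2l K0 (le_trans aa (lerD (ltW ua) (lexx _))))) _.
rewrite mulrDr addrA addrC lerD2l -{1}(mul1r (e / _)) -mulrDl addrC.
by rewrite mulrC divfK // gt_eqF.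
Qed.

(** [Gr] is a relation because a rule on finite sums of generators is not known in advance to be
    well defined. The bound [GrK], applied to differences, gives both single-valuedness and
    continuity. *)
Lemma dense_graph_extension : exists2 f : U -> V, bounded_linear_map f &
  forall u v, Gr u v -> f u = v.
Proof.
have [f Hf] := choice cl_total; exists f.
  (* Two values over [u] differ by a value over [u - u = 0], whose norm is at most [K * 0]. *)
  have cl_fun u v v' : cl u v -> cl u v' -> v = v'.
    move=> H H'; apply/eqP; rewrite -subr_eq0 -normr_le0.
    rewrite -[leRHS](mulr0 K) -[0 in leRHS](@normr0 _ U) -(subrr u); apply: clK.
    by rewrite -(scaleN1r v') -(scaleN1r u); apply/clD/clZ.
  split=> [x y|k x|].
  - by apply: cl_fun (Hf _) _; exact: clD.
  - by apply: cl_fun (Hf _) _; exact: clZ.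
  - by exists K => // x; exact: clK.
move=> u v g.
apply/eqP; rewrite -subr_eq0 -normr_le0.
rewrite -[leRHS](mulr0 K) -[0 in leRHS](@normr0 _ U) -(subrr u); apply: clK.
by rewrite -(scaleN1r v) -(scaleN1r u); apply/clD/clZ/cl_gr.
Qed.

End Extension.

(** * Hilbert modules *)

(** Avoids square roots: [K <= (1 + K) ^+ 2], so [1 + K] serves in place of the root of [K]. *)
Lemma sqr_bound (R : realType) (x y K : R[i]) : 0 <= x -> 0 <= y -> 0 <= K ->
  x ^+ 2 <= K * y ^+ 2 -> x <= (1 + K) * y.
Proof.
move=> x0 y0 K0 H.
rewrite -(@ler_pXn2r _ 2) ?nnegrE ?mulr_ge0 ?addr_ge0 // exprMn.
apply: le_trans H _; rewrite ler_wpM2r ?exprn_ge0 //.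
have K1 : K <= 1 + K by rewrite lerDr.
by apply: le_trans K1 _; rewrite expr2 ler_peMr ?addr_ge0 // lerDl.
Qed.

Section HilbertModules.
Variable R : realType.

(** The C*-identity gives [|b|^2 <= |star b| |b|]; cancelling [|b|] yields one inequality, used for
    [a] and for [star a]. *)
Lemma norm_star (A : cstarType R) (a : A) : `|star a| = `|a|.
Proof.
have le (b : A) : `|b| <= `|star b|.
  have [->|b0] := eqVneq b 0; first by rewrite normr0.
  have b1 : 0 < `|b| by rewrite normr_gt0.
  by rewrite -(ler_pM2r b1) -expr2 -cnorm_star cnormM.
by apply/eqP; rewrite eq_le le andbT; have := le (star a); rewrite starK.
Qed.

(* Restatements of [starM] and [cnormM] for the ring product, which unfolds to
   [cmul] but does not match it syntactically. *)
Lemma star_mul (A : cstarType R) (a b : A) : star (a * b) = star b * star a.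
Proof. exact: starM. Qed.

Lemma norm_mul (A : cstarType R) (a b : A) : `|a * b| <= `|a| * `|b|.
Proof. exact: cnormM. Qed.

Lemma star1 (A : cstarType R) : star (1 : A) = 1.
Proof.
by have := star_mul (star (1 : A)) 1; rewrite mulr1 starK mulr1 => <-.
Qed.

Variable B : cstarType R.
Implicit Types E F G : hilbert_module B.

Lemma innerDl E (x y z : E) : inner E (x + y) z = inner E x z + inner E y z.
Proof. by rewrite -[LHS]inner_star innerDr starD !inner_star. Qed.

Lemma innerZl E (k : R[i]) (x y : E) :
  inner E (k *: x) y = (k^*)%C *: inner E x y.
Proof. by rewrite -[LHS]inner_star innerZr starZ inner_star. Qed.

Lemma innerNl E (x y : E) : inner E (- x) y = - inner E x y.
Proof. by rewrite -(scaleN1r x) innerZl rmorphN rmorph1 scaleN1r. Qed.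

Lemma innerNr E (x y : E) : inner E x (- y) = - inner E x y.
Proof. by rewrite -(scaleN1r y) innerZr scaleN1r. Qed.

Lemma inner_ractl E (x y : E) b : inner E (ract E x b) y = star b * inner E x y.
Proof. by rewrite -[LHS]inner_star inner_ract star_mul inner_star. Qed.

Lemma inner0r E (x : E) : inner E x 0 = 0.
Proof. by rewrite -(scale0r (0 : E)) innerZr scale0r. Qed.

Lemma inner0l E (x : E) : inner E 0 x = 0.
Proof. by rewrite -(scale0r (0 : E)) innerZl rmorph0 scale0r. Qed.

Lemma inner_diff E (x y : E) : inner E (x + y) (x + y) - inner E (x - y) (x - y)
  = 2%:R *: (inner E x y + inner E y x).
Proof.
rewrite !(innerDl, innerDr, innerNl, innerNr).
set a := inner E x x; set b := inner E x y; set c := inner E y x; set d := inner E y y.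
have -> : a + b + (c + d) = (a + d) + (b + c) by rewrite (addrC c) addrACA.
have -> : a - b + (- c - - d) = (a + d) - (b + c).
  by rewrite (addrC (- c)) opprK addrACA -opprD.
by rewrite opprB addrC addrA subrK scaler_nat mulr2n.
Qed.

Lemma inner_polarization E (x y : E) :
  4%:R *: inner E x y = inner E (x + y) (x + y) - inner E (x - y) (x - y)
    - 'i *: (inner E (x + 'i *: y) (x + 'i *: y)
             - inner E (x - 'i *: y) (x - 'i *: y)).
Proof.
rewrite !inner_diff innerZl innerZr.
have -> : ('i^*)%C = - 'i :> R[i] by apply/eqP; rewrite eq_complex /= oppr0 !eqxx.
set b := inner E x y; set c := inner E y x.
have -> : 'i *: (2%:R *: ('i *: b + - 'i *: c)) = 2%:R *: (c - b).
  rewrite scalerA mulrC -scalerA; congr (_ *: _).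
  by rewrite scalerDr !scalerA mulrN -expr2 sqr_i opprK scale1r scaleN1r addrC.
rewrite -scalerBr opprB addrACA subrr addr0.
by rewrite -mulr2n -(scaler_nat 2 b) scalerA -natrM.
Qed.

Lemma inner_bound E (x y : E) : `|inner E x y| <= 4%:R * (`|x| * `|y|).
Proof.
have [->|x0] := eqVneq x 0; first by rewrite inner0l !normr0 mul0r mulr0.
have [->|y0] := eqVneq y 0; first by rewrite inner0r !normr0 !mulr0.
have unit_case (u v : E) : `|u| <= 1 -> `|v| <= 1 -> `|inner E u v| <= 4%:R.
  move=> u1 v1; rewrite -(@ler_pM2l _ 4%:R) // -{1}(@normr_nat R[i] 4) -normrZ.
  rewrite inner_polarization.
  have q (z w : E) : `|z| <= 1 -> `|w| <= 1 -> `|inner E (z + w) (z + w)| <= 4%:R.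
    move=> z1 w1; rewrite -hnormE (_ : 4%:R = 2%:R ^+ 2); last by rewrite -natrX.
    rewrite ler_pXn2r ?nnegrE //; apply: le_trans (ler_normD _ _) _.
    by rewrite -[2%:R]/(1 + 1) lerD.
  have Ni : `|'i : R[i]| = 1 by rewrite normc_def /= expr0n expr1n add0r sqrtr1.
  have iv : `|'i *: v| <= 1 by rewrite normrZ Ni mul1r.
  (* Polarization has four terms [<z, z>], each with [|z| <= 2] and so of norm at most 4. *)
  have -> : 4%:R * 4%:R = 4%:R + 4%:R + (4%:R + 4%:R) :> R[i] by rewrite -!natrD -natrM.
  apply: le_trans (ler_normB _ _) _; rewrite normrZ Ni mul1r.
  by apply: lerD; apply: le_trans (ler_normB _ _) _; apply: lerD; apply: q;
     rewrite ?normrN.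
have nx : 0 < `|x| by rewrite normr_gt0.
have ny : 0 < `|y| by rewrite normr_gt0.
have := unit_case (`|x|^-1 *: x) (`|y|^-1 *: y).
rewrite !normrZ !normfV !normr_id !mulVf ?gt_eqF // => /(_ (lexx _) (lexx _)).
rewrite innerZl innerZr !normrZ normcJ !normfV !normr_id.
by rewrite mulrA -invfM ler_pdivrMl ?mulr_gt0 // mulrC.
Qed.

Lemma inner_eq E (x y : E) : (forall z, inner E z x = inner E z y) -> x = y.
Proof.
move=> H; apply/eqP; rewrite -subr_eq0 -normr_eq0 -sqrf_eq0 hnormE.
by rewrite innerDr innerNr H subrr normr0.
Qed.

Lemma ract_norm E (x : E) b : `|ract E x b| <= `|x| * `|b|.
Proof.
rewrite -(@ler_pXn2r _ 2) ?nnegrE ?mulr_ge0 //.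
rewrite hnormE inner_ract inner_ractl exprMn hnormE.
apply: le_trans (norm_mul _ _) _; rewrite expr2 mulrA ler_wpM2r //.
by apply: le_trans (norm_mul _ _) _; rewrite norm_star mulrC.
Qed.

Lemma blin_ract E b : bounded_linear_map (fun x : E => ract E x b).
Proof.
split=> [x y|k x|]; [exact: ractDl|exact: ractZl|].
by exists `|b| => // x; rewrite mulrC ract_norm.
Qed.

Lemma blin_inner E (x : E) : bounded_linear_map (inner E x).
Proof.
split=> [y z|k y|]; [exact: innerDr|exact: innerZr|].
by exists (4%:R * `|x|) => [|y]; rewrite ?mulr_ge0 // -mulrA inner_bound.
Qed.

Lemma blin_aop E F (T : adjointable E F) : bounded_linear_map T.
Proof.
split=> [y z|k y|]; [exact: aopD|exact: aopZ|].
(* [aop_bounded] does not say that [M] is nonnegative; since [M * |x|] bounds a norm, it equals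
   [|M| * |x|]. *)
have [M HM] := aop_bounded T; exists `|M| => // x; apply: le_trans (HM x) _.
have : 0 <= M * `|x| by apply: le_trans (HM x).
by move/ger0_norm => <-; rewrite normrM normr_id.
Qed.

(** Taking [x := x'] gives [|x'|^2 = |<T x', y>| <= 4 M |x'| |y|]. The bound concerns each pair
    [(y, x')] separately, so it is available before [T] has an adjoint. *)
Lemma weak_adjoint_bound E F (T : E -> F) : bounded_linear_map T ->
  exists2 K : R[i], 0 <= K & forall y x',
    (forall x, inner F (T x) y = inner E x x') -> `|x'| <= K * `|y|.
Proof.
move=> [_ _ [M M0 TM]]; exists (4%:R * M) => [|y x' H]; first by rewrite mulr_ge0.
have [->|x0] := eqVneq x' 0; first by rewrite normr0 mulr_ge0 // mulr_ge0.
have x1 : 0 < `|x'| by rewrite normr_gt0.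
rewrite -(ler_pM2r x1) -expr2 hnormE -H.
apply: le_trans (inner_bound _ _) _; rewrite -!mulrA ler_wpM2l //.
by rewrite (mulrC `|y|) mulrA ler_wpM2r.
Qed.

Lemma blin_aadj E F (T : adjointable E F) : bounded_linear_map (aadj T).
Proof.
split=> [x y|k x|].
- by apply: inner_eq => z; rewrite innerDr -!aadjP innerDr.
- by apply: inner_eq => z; rewrite innerZr -!aadjP innerZr.
have [K K0 HK] := weak_adjoint_bound (blin_aop T).
by exists K => // y; apply: HK => x; rewrite aadjP.
Qed.

(** The pairs [(y, x')] in which [x'] acts as an adjoint value at [y] form a bounded linear
    relation, and its domain contains the span of [S]; its extension is the adjoint. *)
Lemma densely_adjointable E F (T : E -> F) (S : set F) :
  bounded_linear_map T -> (forall x b, T (ract E x b) = ract F (T x) b) ->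
  closed_span S = setT ->
  (forall s, S s -> exists x', forall x, inner F (T x) s = inner E x x') ->
  exists T' : adjointable E F, forall x, T' x = T x.
Proof.
move=> HT Tb ST Sadj; have [K K0 HK] := weak_adjoint_bound HT.
pose Gr y x' := forall x, inner F (T x) y = inner E x x'.
have [|||f Hf fG] := @dense_graph_extension _ _ _ Gr K _ _ K0 HK.
- by move=> y x y' x' g g' z; rewrite !innerDr g g'.
- by move=> k y x g z; rewrite !innerZr g.
- apply: (@dense_ind _ _ S [set y | exists x, Gr y x] ST) => //=.
  + by exists 0 => x; rewrite !inner0r.
  + move=> y y' [x g] [x' g']; exists (x + x') => z.
    by rewrite !innerDr g g'.
  + by move=> k y [x g]; exists (k *: x) => z; rewrite !innerZr g.
have [TD TZ [M M0 TM]] := HT.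
have adj x y : inner F (T x) y = inner E x (f y).
  move: y; apply: (blin_eq ST) => [||s Ss]; first exact: blin_inner.
  - by apply: blin_comp Hf; exact: blin_inner.
  - by have [x' Hx'] := Sadj s Ss; rewrite (fG _ _ Hx') Hx'.
by exists (Adjointable TD TZ Tb (ex_intro _ M TM) adj).
Qed.

End HilbertModules.

(** * Maps of Hilbert modules prescribed on generators *)

Section InnerExtension.
Variables (R : realType) (A B : cstarType R).
Variables (E : hilbert_module A) (P : hilbert_module B).
Variables (F : A -> B) (F_blin : bounded_linear_map F).
Variables (I : Type) (g : I -> E) (h : I -> P).
Hypothesis g_dense : closed_span [set e | exists i, e = g i] = setT.
Hypothesis gh : forall i j, inner P (h i) (h j) = F (inner E (g i) (g j)).

(** The relation [<v, v> = F <u, u>] passes from generators to finite sums and gives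
    [|v|^2 <= M |u|^2]. With [F] the identity this yields isometries; with [F a = <x, a x>] it
    yields [e |-> e (x) x] for fixed [x]. *)
Lemma inner_extension : exists2 f : E -> P, bounded_linear_map f &
  forall i, f (g i) = h i.
Proof.
pose Gr (u : E) (v : P) := exists s : seq (R[i] * I),
  u = \sum_(p <- s) p.1 *: g p.2 /\ v = \sum_(p <- s) p.1 *: h p.2.
have [FD FZ [M M0 FM]] := F_blin.
have GrD u v u' v' : Gr u v -> Gr u' v' -> Gr (u + u') (v + v').
  by move=> [s [-> ->]] [s' [-> ->]]; exists (s ++ s'); rewrite !big_cat.
have GrZ (k : R[i]) u v : Gr u v -> Gr (k *: u) (k *: v).
  move=> [s [-> ->]]; exists [seq (k * p.1, p.2) | p <- s].
  rewrite !scaler_sumr !big_map /=.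
  by split; apply: eq_bigr => p _; rewrite scalerA.
have Gri i : Gr (g i) (h i).
  by exists [:: (1, i)]; rewrite !big_seq1 !scale1r.
have Gr0 : Gr 0 0 by exists [::]; rewrite !big_nil.
have Grin u v u' v' : Gr u v -> Gr u' v' -> inner P v v' = F (inner E u u').
  have half i : Gr u' v' -> inner P (h i) v' = F (inner E (g i) u').
    case=> s [-> ->]; elim: s => [|p s IH]; first by rewrite !big_nil !inner0r blin0.
    by rewrite !big_cons !innerDr !innerZr IH FD FZ gh.
  move=> [s [-> ->]] g'; elim: s => [|p s IH].
    by rewrite !big_nil !inner0l blin0.
  by rewrite !big_cons !innerDl !innerZl IH FD FZ half.
have [] := @dense_graph_extension R E P Gr (1 + M) GrD GrZ.
- by rewrite addr_ge0.
- move=> u v g0; apply: sqr_bound => //.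
  by rewrite hnormE (Grin _ _ _ _ g0 g0) (hnormE u).
- apply: (@dense_ind _ _ _ [set u | exists v, Gr u v] g_dense) => /=.
  + by exists 0.
  + by move=> u u' [v gv] [v' gv']; exists (v + v'); exact: GrD.
  + by move=> k u [v gv]; exists (k *: v); exact: GrZ.
  + by move=> _ [i ->]; exists (h i).
by move=> f Hf fG; exists f => // i; exact: fG.
Qed.

End InnerExtension.

(** * The Neumann series *)

Section Neumann.
Variable R : realType.

Lemma half_power_small (d : R[i]) : 0 < d -> exists N : nat, 2^-1 ^+ N < d.
Proof.
move=> d0; have [r dr] := complex_realP _ (gtr0_real d0).
have r0 : 0 < r by move: d0; rewrite dr ltcR.
exists (Num.bound r^-1).
have lt : r^-1 < 2 ^+ Num.bound r^-1.
  apply: lt_trans (archi_boundP _) _; first by rewrite invr_ge0 ltW.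
  by rewrite -natrX ltr_nat ltn_expl.
have : 2^-1 ^+ Num.bound r^-1 < r by rewrite exprVn invf_plt // posrE exprn_gt0.
by rewrite dr -ltcR rmorphXn /= fmorphV rmorph_nat.
Qed.

Lemma right_inverse_near1 (A : cstarType R) (u : A) :
  `|1 - u| <= 2^-1 -> exists w, u * w = 1.
Proof.
(* The norm of the unit is kept as [c]: it is 0 in the zero algebra, which is allowed. *)
set h := 1 - u => h2; pose c := `|1 : A|.
pose w n := \sum_(k < n) h ^+ k.
have c0 : 0 <= c by exact: normr_ge0.
have hn n : `|h ^+ n| <= c * 2^-1 ^+ n.
  elim: n => [|n IH]; first by rewrite !expr0 mulr1.
  rewrite exprS; apply: le_trans (norm_mul _ _) _.
  by rewrite exprS mulrCA ler_pM.
have p0 n : 0 <= 2^-1 ^+ n :> R[i] by rewrite exprn_ge0 // invr_ge0.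
have wB n k : `|w (n + k)%N - w n| <= c * 2 * (2^-1 ^+ n - 2^-1 ^+ (n + k)).
  elim: k => [|k IH]; first by rewrite addn0 !subrr normr0 mulr0.
  rewrite addnS /w big_ord_recr /= addrAC; apply: le_trans (ler_normD _ _) _.
  apply: le_trans (lerD IH (hn _)) _.
  rewrite exprS le_eqVlt; apply/orP; left; apply/eqP.
  by field.
have small e : 0 < e -> exists N, forall n, (N <= n)%N ->
    c * 2 * 2^-1 ^+ n < e.
  move=> e0; have c1 : 0 < c * 2 + 1 by rewrite ltr_wpDl // mulr_ge0.
  have [|N HN] := @half_power_small (e / (c * 2 + 1)); first by rewrite divr_gt0.
  exists N => n Nn; move: HN; rewrite ltr_pdivlMr // => HN.
  apply: le_lt_trans HN; rewrite mulrC; apply: ler_pM => //.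
  - exact: mulr_ge0.
  - by apply: ler_wiXn2l => //; rewrite ?invr_ge0 // invf_le1 // ler1n.
  - by rewrite lerDl.
have : cvg (w n @[n --> \oo]).
  apply: cauchy_cvg; apply/cauchy_exP => e e0.
  have [N HN] := small e e0; exists (w N); exists N => // n /= Nn.
  rewrite -ball_normE /= distrC -(subnKC Nn); apply: le_lt_trans (wB _ _) _.
  apply: le_lt_trans (HN N (leqnn _)); rewrite ler_wpM2l ?mulr_ge0 //.
  by rewrite gerBl.
move=> /cvg_ex [l Hl]; exists l; apply/esym/eqP; rewrite -subr_eq0; apply/eqP.
(* [1 - u l = h^n - u (l - w n)]: the first term contributes [e], the second [|u| e]. *)
apply: (@approx_eq0 _ _ _ (1 + `|u|)) => [|e e0]; first by rewrite addr_ge0.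
have [N HN] := small e e0.
have [M _ HM] : \forall n \near \oo, ball l e (w n) by apply/Hl/nbhsx_ballx.
pose n := maxn N M.
have uw : u * w n = 1 - h ^+ n.
  have -> : u = 1 - h by rewrite /h subKr.
  rewrite /w; elim: (n) => [|k IH]; first by rewrite big_ord0 mulr0 expr0 subrr.
  by rewrite big_ord_recr /= mulrDr IH mulrBl mul1r exprS addrA subrK.
rewrite (_ : 1 - u * l = h ^+ n - u * (l - w n)); last first.
  by rewrite mulrBr uw opprB addrA (addrC (h ^+ n)) subrK.
apply: le_trans (ler_normB _ _) _; rewrite mulrDl mul1r lerD //.
- apply: le_trans (hn n) _; apply: le_trans (ltW (HN n (leq_maxl _ _))).
  by rewrite -mulrA ler_wpM2l // ler_peMl // ler1n.
- apply: le_trans (norm_mul _ _) _; rewrite ler_wpM2l // ltW //.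
  by have := HM n (leq_maxr _ _); rewrite -ball_normE.
Qed.

End Neumann.

(** * Equivalence bimodules *)

Section Bimodules.
Variables (R : realType).

Lemma lact_norm (A B : cstarType R) (X : equivalence_bimodule A B) a (x : X) :
  `|lact X a x| <= `|a| * `|x|.
Proof.
rewrite -(@ler_pXn2r _ 2) ?nnegrE ?mulr_ge0 //.
rewrite lnormE linner_lact -linner_star linner_lact star_mul linner_star.
rewrite exprMn lnormE.
apply: le_trans (norm_mul _ _) _; rewrite expr2 -mulrA ler_wpM2l //.
by apply: le_trans (norm_mul _ _) _; rewrite norm_star mulrC.
Qed.

Lemma blin_lact_app (A B : cstarType R) (X : equivalence_bimodule A B) (x : X) :
  bounded_linear_map (fun a => lact X a x).
Proof.
have [lD lZ _ _] := lact_hom X; split=> [a b|k a|]; [exact: lD|exact: lZ|].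
by exists `|x| => // a; rewrite mulrC lact_norm.
Qed.

Lemma linner_eq (A B : cstarType R) (X : equivalence_bimodule A B) (x y : X) :
  (forall z, linner X x z = linner X y z) -> x = y.
Proof.
move=> H; apply/eqP; rewrite -subr_eq0 -normr_eq0 -sqrf_eq0 lnormE.
by rewrite linnerDl -(scaleN1r y) linnerZl H !scaleN1r subrr normr0.
Qed.

(** Unitality is not part of [star_hom]; here it comes from the left inner product, which is
    [A]-linear and separates points. *)
Lemma lact1 (A B : cstarType R) (X : equivalence_bimodule A B) (x : X) :
  lact X 1 x = x.
Proof. by apply: linner_eq => z; rewrite linner_lact mul1r. Qed.

(* An honest finite sum: some element of the linear span is right invertible,
   and its right inverse is absorbed in the second argument. *)
Lemma linner_unit (A B : cstarType R) (X : equivalence_bimodule A B) :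
  linear_span [set a | exists x y, a = linner X x y] 1.
Proof.
have /closed_spanP/(_ 2^-1) [|u Su u1] :
    closed_span [set a | exists x y, a = linner X x y] (1 : A).
- by rewrite linner_full.
- by rewrite invr_gt0.
have [w uw] := right_inverse_near1 (ltW u1).
rewrite -[X in linear_span _ X]uw.
suff : linear_span [set a | exists x y, a = linner X x y] `<=`
    [set u | linear_span [set a | exists x y, a = linner X x y] (u * w)] by apply.
apply: linear_span_ind => /=.
- by rewrite mul0r; exact: linear_span0.
- by move=> x y Sx Sy; rewrite mulrDl; exact: linear_spanD.
- move=> k x Sx; have -> : (k *: x) * w = k *: (x * w) by rewrite [RHS]cscaleAl.
  exact: linear_spanZ.
- move=> _ [x [y ->]]; apply: linear_span_gen; exists x, (lact X (star w) y).
  by rewrite -[RHS]linner_star linner_lact star_mul starK linner_star.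
Qed.

End Bimodules.

(** * Representations and tensor products *)

Section StarHom.
Variables (R : realType) (C B : cstarType R) (E : hilbert_module B).
Variables (pi : C -> adjointable E E) (pi_hom : star_hom pi).

Lemma star_hom_adj c x y : inner E (pi c x) y = inner E x (pi (star c) y).
Proof. by have [_ _ _ piS] := pi_hom; rewrite piS -aadjP. Qed.

Lemma star_hom_inner c d x y :
  inner E (pi c x) (pi d y) = inner E x (pi (star c * d) y).
Proof. by have [_ _ piM _] := pi_hom; rewrite star_hom_adj piM. Qed.

(** [pi 1] fixes every [pi c x], and these span a dense subspace. *)
Lemma nondegenerate1 : Defs.nondegenerate pi -> forall x, pi 1 x = x.
Proof.
move=> nd; have [_ _ piM _] := pi_hom.
apply: (blin_eq nd); [exact: blin_aop|exact: blin_id|].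
by move=> _ [c [x ->]]; rewrite -piM mul1r.
Qed.

Lemma nondegenerate_of1 : (forall x, pi 1 x = x) -> Defs.nondegenerate pi.
Proof.
move=> pi1; rewrite /Defs.nondegenerate eqEsubset; split=> // x _.
by apply: closed_span_gen; exists 1, x; rewrite pi1.
Qed.

End StarHom.

(** * From KSGNS representations to tensor products *)

Lemma dense_span_gen (R : realType) (V : normedModType R[i]) (S S' : set V) :
  closed_span S = setT -> S `<=` S' -> closed_span S' = setT.
Proof.
move=> ST SS; rewrite eqEsubset; split=> // v _.
by apply: (blin_closed_span ST (@blin_id _ _)) => s /SS; exact: closed_span_gen.
Qed.

(** The tensor map is built for one [x] at a time by [inner_extension]; its linearity in [x] is then
    read off on the generators [t c a] and extended by density. *)
Lemma ksgns_tensor (R : realType) (C A B : cstarType R) (phi : C -> A)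
    (E : correspondence C A) (X : equivalence_bimodule A B)
    (Et : hilbert_module B) (pi : C -> adjointable Et Et)
    (V : adjointable X Et) (pi_hom : star_hom pi) :
  is_GNS phi E -> minimal_KSGNS (fun c => lact X (phi c)) pi V ->
  is_tensor E X (Correspondence pi_hom).
Proof.
move=> [t [_ t_inner t_lact t_ract t_dense]] [_ V_theta V_dense].
have [_ _ piM _] := pi_hom; have [_ _ lM _] := lact_hom X.
have blinF x y : bounded_linear_map (fun a => inner X x (lact X a y)).
  exact: (blin_comp (blin_inner x) (blin_lact_app y)).
pose h (p : C * A) x : Et := pi p.1 (V (lact X p.2 x)).
(* Moving everything to the right turns [V^* pi(c^* c1) V] into [phi(c^* c1)], framed by [a^*] and
   [a1]: the GNS inner product. *)
have h_inner p q x y : inner Et (h p x) (h q y) =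
    inner X x (lact X (inner E (t p.1 p.2) (t q.1 q.2)) y).
  rewrite /h star_hom_inner // aadjP -V_theta star_hom_adj; last exact: lact_hom.
  by rewrite -!lM t_inner.
have g_dense : closed_span [set e | exists p : C * A, e = t p.1 p.2] = setT.
  apply: dense_span_gen t_dense _ => _ [c [a ->]].
  by exists (c, a).
have ext x : exists2 f : E -> Et, bounded_linear_map f &
    forall p : C * A, f (t p.1 p.2) = h p x.
  exact: (inner_extension (blinF x x) g_dense (fun p q => h_inner p q x x)).
have [f fP] := choice (fun x => let: ex_intro2 f b e := ext x in
  ex_intro (fun f : E -> Et => bounded_linear_map f /\
    forall p : C * A, f (t p.1 p.2) = h p x) f (conj b e)).
have f_blin x : bounded_linear_map (f x) by case: (fP x).
have fE x p : f x (t p.1 p.2) = h p x by case: (fP x).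
have fE' c a x : f x (t c a) = pi c (V (lact X a x)) by rewrite (fE x (c, a)).
exists (fun e x => f x e); split.
  split=> [u u' v|k u v|u v v'|k u v].
  - by case: (f_blin v).
  - by case: (f_blin v).
  - move: u; apply: (blin_eq g_dense) => //; first exact: blin_add.
    by move=> _ [p ->]; rewrite !fE /h !aopD.
  - move: u; apply: (blin_eq g_dense) => //; first exact: blin_scale.
    by move=> _ [p ->]; rewrite !fE /h !aopZ.
split=> /=.
- move=> e a x; move: e; apply: (blin_eq g_dense) => //.
    by apply: blin_comp => //; exact: blin_ract.
  by move=> _ [p ->]; rewrite t_ract fE fE' /h lM.
- move=> e x e1 x1; move: e1; apply: (blin_eq g_dense).
  + exact: (blin_comp (blin_inner _) (f_blin x1)).
  + exact: (blin_comp (blinF x x1) (blin_inner e)).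
  (* The inner product is conjugate-linear in [e]; taking stars makes both sides linear, so that
     density applies again. *)
  move=> _ [q ->]; rewrite -[LHS]inner_star -[RHS]inner_star; congr star.
  rewrite star_hom_adj ?inner_star; last exact: lact_hom.
  move: e; apply: (blin_eq g_dense).
  + exact: (blin_comp (blin_inner _) (f_blin x)).
  + exact: (blin_comp (blinF x1 x) (blin_inner _)).
  by move=> _ [p ->]; rewrite !fE h_inner.
- move=> c e x; move: e; apply: (blin_eq g_dense).
  + exact: (blin_comp (blin_aop (pi c)) (f_blin x)).
  + exact: (blin_comp (f_blin x) (blin_aop (lact E c))).
  by move=> _ [p ->]; rewrite t_lact fE fE' /h piM.
- move=> e x b; move: e; apply: (blin_eq g_dense) => //.
    exact: (blin_comp (blin_ract Et b) (f_blin x)).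
  by move=> _ [p ->]; rewrite !fE /h !aop_ract.
- apply: dense_span_gen V_dense _ => _ [c [x ->]].
  by exists (t c 1), x; rewrite fE' lact1.
Qed.

Lemma GNS_ksgns_iso (R : realType) (D B : cstarType R) (psi : D -> B)
    (E : correspondence D B) (Ft : hilbert_module B)
    (rho : D -> adjointable Ft Ft) (W : adjointable (self_module B) Ft) :
  is_GNS psi E -> minimal_KSGNS (fun d => lmul_op (psi d)) rho W ->
  exists U : E -> Ft,
    [/\ bounded_linear_map U,
        forall x y, inner Ft (U x) (U y) = inner E x y,
        forall x b, U (ract E x b) = ract Ft (U x) b,
        forall d x, U (lact E d x) = rho d (U x)
      & forall y, exists x, U x = y].
Proof.
move=> [t [_ t_inner t_lact t_ract t_dense]] [rho_hom W_psi W_dense].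
have [_ _ rhoM _] := rho_hom.
pose g (p : D * B) : E := t p.1 p.2.
pose h (p : D * B) : Ft := rho p.1 (W p.2).
have h_inner p q : inner Ft (h p) (h q) = inner E (g p) (g q).
  by rewrite /h star_hom_inner // aadjP -W_psi t_inner /= mulrA.
have g_dense : closed_span [set e | exists p, e = g p] = setT.
  by apply: dense_span_gen t_dense _ => _ [c [a ->]]; exists (c, a).
have h_dense : closed_span [set e | exists p, e = h p] = setT.
  by apply: dense_span_gen W_dense _ => _ [c [a ->]]; exists (c, a).
have [U U_blin Ug] := inner_extension (@blin_id _ B) g_dense h_inner.
(* The inverse of [U], obtained by exchanging the two families of generators. *)
have [U' U'_blin U'h] :=
  inner_extension (@blin_id _ B) h_dense (fun p q => esym (h_inner p q)).
exists U; split=> //.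
- move=> x y; move: y; apply: (blin_eq g_dense).
  + exact: (blin_comp (blin_inner _) U_blin).
  + exact: blin_inner.
  move=> _ [q ->]; rewrite -[LHS]inner_star -[RHS]inner_star; congr star.
  move: x; apply: (blin_eq g_dense).
  + exact: (blin_comp (blin_inner _) U_blin).
  + exact: blin_inner.
  by move=> _ [p ->]; rewrite !Ug h_inner.
- move=> x b; move: x; apply: (blin_eq g_dense).
  + exact: (blin_comp U_blin (blin_ract E b)).
  + exact: (blin_comp (blin_ract Ft b) U_blin).
  move=> _ [p ->]; rewrite t_ract Ug -[t _ _]/(g (p.1, p.2 * b)) Ug /h /=.
  by rewrite -aop_ract -aop_ract.
- move=> d x; move: x; apply: (blin_eq g_dense).
  + exact: (blin_comp U_blin (blin_aop (lact E d))).
  + exact: (blin_comp (blin_aop (rho d)) U_blin).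
  move=> _ [p ->]; rewrite t_lact Ug -[t _ _]/(g (d * p.1, p.2)) Ug /h /=.
  by rewrite rhoM.
- move=> y; exists (U' y); move: y; apply: (blin_eq h_dense).
  + exact: blin_comp.
  + exact: blin_id.
  by move=> _ [p ->]; rewrite U'h Ug.
Qed.

(** The inner product formula is the relation for [pi_Y(y)^* pi_Y(z)]. For the range, writing 1 as a
    finite sum of [<y, z>] makes [e] a finite sum of vectors [pi_Y(y) pi_Y(z)^* e]; since the sum is
    finite, no continuity of [c |-> pi(c) e] enters. *)
Lemma representation_tensor (R : realType) (C D B : cstarType R)
    (Y : equivalence_bimodule C D) (F : correspondence D B)
    (Et Ft : hilbert_module B) (pi : C -> adjointable Et Et)
    (rho : D -> adjointable Ft Ft) (piY : Y -> adjointable Ft Et) (U : F -> Ft)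
    (pi_hom : star_hom pi) :
  (forall x, pi 1 x = x) -> (forall x, rho 1 x = x) ->
  (forall y z f, piY (y + z) f = piY y f + piY z f) ->
  (forall (k : R[i]) y f, piY (k *: y) f = k *: piY y f) ->
  (forall y z e, piY y (aadj (piY z) e) = pi (linner Y y z) e) ->
  (forall y z f, aadj (piY y) (piY z f) = rho (inner Y y z) f) ->
  (forall c y d f,
     piY (lact Y c (ract Y y d)) f = pi c (piY y (rho d f))) ->
  bounded_linear_map U ->
  (forall x y, inner Ft (U x) (U y) = inner F x y) ->
  (forall x b, U (ract F x b) = ract Ft (U x) b) ->
  (forall d x, U (lact F d x) = rho d (U x)) ->
  (forall y, exists x, U x = y) ->
  is_tensor Y F (Correspondence pi_hom).
Proof.
move=> pi1 rho1 YD YZ Yl Yr Ya [UD UZ _] U_inner U_ract U_lact U_onto.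
have [piD piZ _ _] := pi_hom.
(* The joint relation [Ya] splits into one for each action by inserting a unit on the other side. *)
have Yc c y f : piY (lact Y c y) f = pi c (piY y f).
  by rewrite -[y in LHS](ract1) Ya rho1.
have Yd y d f : piY (ract Y y d) f = piY y (rho d f).
  by rewrite -[ract _ _ _ in LHS]lact1 Ya pi1.
exists (fun y x => piY y (U x)); split.
  split=> [u u' v|k u v|u v v'|k u v].
  - exact: YD.
  - exact: YZ.
  - by rewrite UD aopD.
  - by rewrite UZ aopZ.
split=> /=.
- by move=> y d x; rewrite Yd U_lact.
- by move=> y x y1 x1; rewrite aadjP Yr -U_lact U_inner.
- by move=> c y x; rewrite Yc.
- by move=> y x b; rewrite U_ract aop_ract.
rewrite eqEsubset; split=> // e _; apply: closed_span_span.
rewrite -[e]pi1.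
suff : linear_span [set c | exists y z, c = linner Y y z] `<=`
    [set c | linear_span [set p | exists y x, p = piY y (U x)] (pi c e)].
  by apply; exact: linner_unit.
apply: linear_span_ind => /=.
- have -> : pi 0 e = 0 by rewrite -(scale0r (0 : C)) piZ scale0r.
  exact: linear_span0.
- by move=> c d Sc Sd; rewrite piD; exact: linear_spanD.
- by move=> k c Sc; rewrite piZ; exact: linear_spanZ.
- move=> _ [y [z ->]]; rewrite /= -Yl; apply: linear_span_gen.
  by have [x <-] := U_onto (aadj (piY z) e); exists y, x.
Qed.

(** * From tensor products to KSGNS representations *)

Section Tensor.
Variables (R : realType) (C D B : cstarType R).
Variables (E : correspondence C D) (F : correspondence D B).
Variables (P : correspondence C B) (t : E -> F -> P).
Hypothesis t_bil : bilinear_map t.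
Hypothesis t_inner : forall e x e1 x1,
  inner P (t e x) (t e1 x1) = inner F x (lact F (inner E e e1) x1).

Lemma tensor_blin_r e : bounded_linear_map (t e).
Proof.
have [_ _ tD tZ] := t_bil; split=> //.
have [_ _ [M M0 HM]] := blin_aop (lact F (inner E e e)).
exists (1 + 4%:R * M) => [|x]; first by rewrite addr_ge0 // mulr_ge0.
apply: sqr_bound => //; first exact: mulr_ge0.
rewrite (hnormE (t e x)) t_inner; apply: le_trans (inner_bound _ _) _.
by rewrite -!mulrA ler_wpM2l // expr2 mulrCA ler_wpM2l.
Qed.

Hypothesis t_ract : forall e x b, ract P (t e x) b = t e (ract F x b).
Hypothesis t_dense : closed_span [set p | exists e x, p = t e x] = setT.

(** The adjoint is explicit only on elementary tensors, [e1 (x) x1 |-> <e, e1> x1], and these span a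
    dense subspace. *)
Lemma tensor_adjointable e : exists T : adjointable F P, forall x, T x = t e x.
Proof.
apply: densely_adjointable (tensor_blin_r e) _ t_dense _ => [x b|].
- by rewrite t_ract.
- move=> _ [e1 [x1 ->]]; exists (lact F (inner E e e1) x1) => x.
  exact: t_inner.
Qed.

End Tensor.

(** Here the bound must be uniform in [e]: [|<e, e> x| <= |e|^2 |x|], from contractivity of the left
    action on [X]. *)
Lemma tensor_blin_l (R : realType) (C A B : cstarType R)
    (E : correspondence C A) (X : equivalence_bimodule A B)
    (P : correspondence C B) (t : E -> X -> P) x :
  bilinear_map t ->
  (forall e x e1 x1,
    inner P (t e x) (t e1 x1) = inner X x (lact X (inner E e e1) x1)) ->
  bounded_linear_map (t^~ x).
Proof.
move=> [tD tZ _ _] t_inner; split=> [u v|k u|]; [exact: tD|exact: tZ|].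
exists (1 + 4%:R * `|x| ^+ 2) => [|e].
  by rewrite addr_ge0 // mulr_ge0 // exprn_ge0.
apply: sqr_bound => //.
rewrite (hnormE (t e x)) t_inner; apply: le_trans (inner_bound _ _) _.
rewrite -mulrA ler_wpM2l // expr2 -mulrA ler_wpM2l //.
by apply: le_trans (lact_norm _ _) _; rewrite (hnormE e) mulrC.
Qed.

Lemma tensor_iso (R : realType) (C D B : cstarType R)
    (E : correspondence C D) (F : correspondence D B) (P Q : correspondence C B) :
  is_tensor E F Q -> correspondence_iso P Q -> is_tensor E F P.
Proof.
move=> [t [t_bil [t_mid t_inner t_lact t_ract t_dense]]].
move=> [Phi [[PhiD PhiZ] Phi_onto Phi_act Phi_inner]].
have [Psi PsiK] := choice Phi_onto.
have Phi_inj x y : Phi x = Phi y -> x = y.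
  by move=> xy; apply: inner_eq => z; rewrite -!Phi_inner xy.
have PhiK x : Psi (Phi x) = x by apply: Phi_inj; rewrite PsiK.
have Psi_inner x y : inner P (Psi x) (Psi y) = inner Q x y.
  by rewrite -Phi_inner !PsiK.
have Psi_blin : bounded_linear_map Psi.
  split=> [x y|k x|].
  - by apply: Phi_inj; rewrite PhiD !PsiK.
  - by apply: Phi_inj; rewrite PhiZ !PsiK.
  exists 1 => // x; rewrite mul1r.
  by rewrite -(@ler_pXn2r _ 2) ?nnegrE // !hnormE Psi_inner.
have [PsiD PsiZ _] := Psi_blin; have [tDl tZl tDr tZr] := t_bil.
(* Right linearity follows from preservation of inner products and surjectivity; the left action is
   then isolated by [b = 1]. *)
have Phi_ract x b : Phi (ract P x b) = ract Q (Phi x) b.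
  apply: inner_eq => z; have [w <-] := Phi_onto z.
  by rewrite Phi_inner !inner_ract Phi_inner.
have Phi_lact c x : Phi (lact P c x) = lact Q c (Phi x).
  by rewrite -[x in LHS]ract1 Phi_act ract1.
exists (fun e x => Psi (t e x)); split.
  split=> [u u' v|k u v|u v v'|k u v].
  - by rewrite tDl PsiD.
  - by rewrite tZl PsiZ.
  - by rewrite tDr PsiD.
  - by rewrite tZr PsiZ.
split.
- by move=> e a x; rewrite t_mid.
- by move=> e x e1 x1; rewrite Psi_inner t_inner.
- by move=> c e x; apply: Phi_inj; rewrite Phi_lact !PsiK t_lact.
- by move=> e x b; apply: Phi_inj; rewrite Phi_ract !PsiK t_ract.
rewrite eqEsubset; split=> // p _; rewrite -[p]PhiK.
apply: (blin_closed_span t_dense Psi_blin) => _ [e [x ->]].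
by apply: closed_span_gen; exists e, x.
Qed.

Lemma tensor_lact1 (R : realType) (C D B : cstarType R)
    (Y : equivalence_bimodule C D) (F : correspondence D B)
    (P : correspondence C B) : is_tensor Y F P -> forall p, lact P 1 p = p.
Proof.
move=> [t [_ [_ _ t_lact _ t_dense]]].
apply: (blin_eq t_dense); [exact: blin_aop|exact: blin_id|].
by move=> _ [y [f ->]]; rewrite t_lact lact1.
Qed.

Lemma GNS_lact1 (R : realType) (C A : cstarType R) (phi : C -> A)
    (E : correspondence C A) : is_GNS phi E -> forall e, lact E 1 e = e.
Proof.
move=> [t [_ _ t_lact _ t_dense]].
apply: (blin_eq t_dense); [exact: blin_aop|exact: blin_id|].
by move=> _ [c [a ->]]; rewrite t_lact mul1r.
Qed.

Lemma tensor_ksgns (R : realType) (C A B : cstarType R) (phi : C -> A)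
    (E : correspondence C A) (X : equivalence_bimodule A B)
    (P : correspondence C B) : is_GNS phi E -> is_tensor E X P ->
  exists V : adjointable X P,
    minimal_KSGNS (fun c => lact X (phi c)) (lact P) V.
Proof.
move=> [g [_ g_inner g_lact g_ract g_dense]] [t [t_bil [t_mid t_inner t_lact t_ract t_dense]]].
have [V VE] := tensor_adjointable t_bil t_inner t_ract t_dense (g 1 1).
exists V; split; first exact: lact_hom.
  move=> c x; apply: inner_eq => z.
  rewrite -aadjP !VE t_lact t_inner g_lact g_inner.
  by rewrite !star1 !mul1r !mulr1.
rewrite eqEsubset; split=> // p _.
(* Two reductions by density lead to [(c (x) a) (x) x], which is [c] applied to [V (a x)]. *)
apply: (blin_closed_span t_dense (@blin_id _ _)) => _ [e [x ->]].
apply: (blin_closed_span g_dense (tensor_blin_l x t_bil t_inner)).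
move=> _ [c [a ->]]; apply: closed_span_gen; exists c, (lact X a x).
by rewrite VE t_lact g_lact mulr1 -t_mid g_ract mul1r.
Qed.

Lemma GNS_ksgns (R : realType) (D B : cstarType R) (psi : D -> B)
    (E : correspondence D B) : is_GNS psi E ->
  exists W : adjointable (self_module B) E,
    minimal_KSGNS (fun d => lmul_op (psi d)) (lact E) W.
Proof.
move=> [g [[_ _ gDr gZr] g_inner g_lact g_ract g_dense]].
have gE b : g 1 b = ract E (g 1 1) b by rewrite g_ract mul1r.
have W_bound : exists M : R[i], forall b : self_module B, `|g 1 b| <= M * `|b|.
  by exists `|g 1 1| => b; rewrite gE; exact: ract_norm.
(* The adjoint of [W] is the inner product with [1 (x) 1]. *)
have W_adj (b : self_module B) e :
    inner E (g 1 b) e = inner (self_module B) b (inner E (g 1 1) e).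
  by rewrite gE inner_ractl.
exists (@Adjointable _ _ (self_module B) E (g 1) (inner E (g 1 1))
  (gDr 1) (fun k x => gZr k 1 x) (fun x b => esym (g_ract 1 x b)) W_bound W_adj).
split=> /=; first exact: lact_hom.
  by move=> d b; rewrite g_lact g_inner !star1 !mul1r mulr1.
apply: dense_span_gen g_dense _ => _ [d [b ->]].
by exists d, b; rewrite g_lact mulr1.
Qed.

Lemma tensor_representation (R : realType) (C D B : cstarType R)
    (Y : equivalence_bimodule C D) (F : correspondence D B)
    (P : correspondence C B) :
  (forall f, lact F 1 f = f) -> is_tensor Y F P ->
  representation_SME (lact P) (lact F).
Proof.
move=> F1 HP; have P1 := tensor_lact1 HP.
split; first exact: nondegenerate_of1.
split; first exact: nondegenerate_of1.
case: HP => t [t_bil [t_mid t_inner t_lact t_ract t_dense]].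
have [T TE] := choice (tensor_adjointable t_bil t_inner t_ract t_dense).
have T_adj y y1 f1 : aadj (T y) (t y1 f1) = lact F (inner Y y y1) f1.
  by apply: inner_eq => z; rewrite -aadjP TE t_inner.
have [tDl tZl _ _] := t_bil.
exists Y, T; split.
  by split=> [y z f|k y f]; rewrite !TE ?tDl ?tZl.
split.
- move=> y z; apply: (blin_eq t_dense).
  + exact: (blin_comp (blin_aop (T y)) (blin_aadj (T z))).
  + exact: blin_aop.
  move=> _ [y1 [f1 ->]].
  (* [y (x) <z, y1> f1 = y <z, y1> (x) f1 = <y, z> y1 (x) f1], by compatibility of the two inner
     products. *)
  by rewrite T_adj TE t_lact linner_inner -t_mid.
- by move=> y z f; rewrite TE T_adj.
- by move=> c y d f; rewrite !TE -t_mid t_lact.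
Qed.

Theorem theorem4p4 (R : realType) (C D A B : cstarType R)
    (phi : {linear C -> A}) (psi : {linear D -> B})
    (phi_cp : completely_positive phi) (psi_cp : completely_positive psi)
    (Ephi : correspondence C A) (Epsi : correspondence D B)
    (Ephi_GNS : is_GNS phi Ephi) (Epsi_GNS : is_GNS psi Epsi) :
  ((exists X : equivalence_bimodule A B,
      cp_SME (fun c => lact X (phi c)) (fun d => lmul_op (psi d))) ->
    correspondence_SME Ephi Epsi) /\
  (correspondence_SME Ephi Epsi ->
    exists X : equivalence_bimodule A B,
      cp_SME (fun c => lact X (phi c)) (fun d => lmul_op (psi d))).
Proof.
split=> [[X [Et [Ft [pi [V [rho [W [Vmin Wmin [pi_nd [rho_nd]]]]]]]]]]|].
  move=> [Y [piY [[YD YZ] [Yl Yr Ya]]]].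
  have pi_hom : star_hom pi by case: Vmin.
  have rho_hom : star_hom rho by case: Wmin.
  have [U [U_blin U_inner U_ract U_lact U_onto]] := GNS_ksgns_iso Epsi_GNS Wmin.
  exists Y, X, (Correspondence pi_hom), (Correspondence pi_hom); split.
  - exact: ksgns_tensor Vmin.
  - apply: (representation_tensor pi_hom (nondegenerate1 pi_hom pi_nd)
      (nondegenerate1 rho_hom rho_nd) YD YZ Yl Yr Ya U_blin) => //.
  (* Both tensor products are realized on the same module [Et], so the isomorphism is the
     identity. *)
  - exists id; split=> // q; by exists q.
move=> [Y [X [P [Q [HP HQ PQ]]]]]; exists X.
have [V Vmin] := tensor_ksgns Ephi_GNS HP.
have [W Wmin] := GNS_ksgns Epsi_GNS.
exists P, Epsi, (lact P), V, (lact Epsi), W; split=> //.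
(* The isomorphism makes [P] itself a tensor product of [Y] and [Epsi]. *)
exact: tensor_representation (GNS_lact1 Epsi_GNS) (tensor_iso HQ PQ).
Qed.
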